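(* For every integer $n\ge 13$, $\gamma^{\mathrm{LOC}}(\mathrm{C}_n(1,3))\ge n/3$.
   Context: For an integer $n\ge 7$, the circulant graph $\mathrm{C}_n(1,3)$ has vertex set $\mathbb{Z}_n$, with $x,y$ adjacent iff $x-y\equiv \pm1$ or $\pm3 \pmod n$. For a graph $G=(V,E)$ and $u\in V$, $N[u]$ is the closed neighbourhood of $u$, and for $S\subseteq V$, $S_u=N[u]\cap S$. A set $S\subseteq V$ is a locating code if the sets $S_u$, $u\in V\setminus S$, are all nonempty and pairwise distinct. $\gamma^{\mathrm{LOC}}(G)$ is the minimum size of a locating code of $G$. *)

(* Defs.v *)
From mathcomp Require Import all_boot all_order all_algebra.

Set Implicit Arguments.
Unset Strict Implicit.
Unset Printing Implicit Defensive.

Import GRing.Theory.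

Section LocatingCode.

Variables (T : finType) (e : rel T).
Implicit Types (S : {set T}) (u v : T).

Definition closed_nbhd u : {set T} := [set v | (v == u) || e u v].

Definition locating_code S : bool :=
  [forall u in ~: S, closed_nbhd u :&: S != set0] &&
  [forall u in ~: S, forall v in ~: S,
     (u != v) ==> (closed_nbhd u :&: S != closed_nbhd v :&: S)].

(* The default value setT of the minimisation is always a locating code
   (locating_codeT), so the minimum is over a nonempty family. *)
Definition gammaLOC : nat := #|[arg min_(S < setT | locating_code S) #|S|]|.

Lemma locating_codeT : locating_code setT.
Proof.
by apply/andP; split; apply/forallP => u; rewrite setCT inE.
Qed.

Lemma gammaLOC_spec :
  (exists2 S, locating_code S & #|S| = gammaLOC) /\
  (forall S, locating_code S -> gammaLOC <= #|S|).
Proof.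
rewrite /gammaLOC; case: arg_minnP => [|S codeS minS]; first exact: locating_codeT.
by split; first by exists S.
Qed.

End LocatingCode.

(* 'Z_n is the ring of integers mod n only for n > 1. *)
Definition circulant13 (n : nat) : rel 'Z_n :=
  fun x y => (x - y)%R \in [:: 1; -1; 3%:R; - 3%:R]%R.

(* Main.v *)
Require Import Defs.
From mathcomp Require Import all_boot all_order all_algebra.
From mathcomp Require Import zify ring.

Set Implicit Arguments.
Unset Strict Implicit.
Unset Printing Implicit Defensive.

Import GRing.Theory Num.Theory.

(** A locating code of C_n(1,3) meets every translate of the three sets
    {0,2,3,4,6}, {0,3,5,8} and {0,2,3,7,8,10}: the first because x+3 is
    dominated, the other two because x+3 is separated from x+5 and from x+7.
    These are constraints on windows of 11 consecutive vertices, and along a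
    sequence of overlapping windows the quantity (number of vertices passed)
    - 3 (number of code vertices passed) stays bounded.  More precisely there
    is a potential on words of length 10 which grows by at least 1 - 3 [x in S]
    when an admissible window slides from x to x+1; summing around the cycle
    gives n <= 3 |S|. *)

Definition admissible (w : seq bool) : bool :=
  all (has (nth false w))
    [:: [:: 0; 2; 3; 4; 6]; [:: 0; 3; 5; 8]; [:: 0; 2; 3; 7; 8; 10]].

Fixpoint all_words (k : nat) (P : pred (seq bool)) : bool :=
  if k is k'.+1 then
    all_words k' (fun s => P (true :: s)) && all_words k' (fun s => P (false :: s))
  else P [::].

Lemma all_wordsP k (P : pred (seq bool)) :
  all_words k P -> forall s, size s = k -> P s.
Proof.
elim: k P => [|k IHk] P /=; first by move=> P0 [].
by move=> /andP[Pt Pf] [|[] s] //= [szs]; [apply: (IHk _ Pt) | apply: (IHk _ Pf)].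
Qed.

(** A table indexed by words of fixed length: each relaxation round looks up the values of the
    previous round instead of recomputing them recursively. *)
Inductive trie := Leaf of nat | Node of trie & trie.

Fixpoint lookup (t : trie) (s : seq bool) : nat :=
  match t, s with
  | Leaf v, _ => v
  | Node t1 t0, b :: s' => lookup (if b then t1 else t0) s'
  | Node _ _, [::] => 0
  end.

Fixpoint tabulate (k : nat) (f : seq bool -> nat) : trie :=
  if k is k'.+1 then
    Node (tabulate k' (fun s => f (true :: s))) (tabulate k' (fun s => f (false :: s)))
  else Leaf (f [::]).

(* One round of longest-path (Bellman-Ford) relaxation; the subtraction is
   truncated, so that values never drop below 0. *)
Definition relax (t : trie) : trie :=
  tabulate 10 (fun s =>
    let via b := if admissible (b :: s)
                 then (lookup t (take 10 (b :: s))).+1 - 3 * b else 0 in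
    maxn (via true) (via false)).

(* Ten rounds reach the fixed point. *)
Definition potential : seq bool -> nat := lookup (iter 10 relax (Leaf 0)).

(** Checking all 2^11 words certifies the table directly, so nothing has to be proved about the
    relaxation. The [let] shares one computed table among all words. *)
Lemma potential_step_computed :
  let t := iter 10 relax (Leaf 0) in
  all_words 11 (fun w => admissible w ==>
    ((lookup t (take 10 w)).+1 <= lookup t (behead w) + 3 * head false w)).
Proof. by vm_compute. Qed.

Lemma potential_step w : size w = 11 -> admissible w ->
  (potential (take 10 w)).+1 <= potential (behead w) + 3 * head false w.
Proof. by move=> szw; apply/implyP/(all_wordsP potential_step_computed). Qed.

Section Circulant.

Variables (n : nat) (S : {set 'Z_n}).
Hypotheses (n_gt4 : 4 < n) (codeS : locating_code (@circulant13 n) S).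

Local Notation N u := (closed_nbhd (@circulant13 n) u).

Definition window k (x : 'Z_n) : seq bool :=
  mkseq (fun i => (x + i%:R)%R \in S) k.

(** Positions of N[x+3] relative to x; centring at x+3 keeps the offsets natural numbers. *)
Definition nbhd_offsets : seq nat := [:: 0; 2; 3; 4; 6].

Lemma mem_nbhdP (x z : 'Z_n) :
  reflect (exists2 i, i \in nbhd_offsets & z = (x + i%:R)%R)
          (z \in N (x + 3%:R)%R).
Proof.
apply: (iffP idP).
  rewrite inE => /orP[/eqP->|]; first by exists 3.
  rewrite /circulant13 !inE.
  (* The differences 1, -1, 3, -3 between x+3 and z give the offsets 2, 4, 0, 6. *)
  by case/or4P=> /eqP E; [exists 2|exists 4|exists 0|exists 6] => //;
    rewrite -[LHS](subKr (x + 3%:R)%R) E; ring.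
case=> i + ->; rewrite /closed_nbhd /circulant13 !inE.
by case/or4P=> [| | |/orP[]] /eqP->;
  apply/orP; (try by left; apply/eqP); right; apply/or4P;
  (try by apply: Or41; apply/eqP; ring); (try by apply: Or42; apply/eqP; ring);
  (try by apply: Or43; apply/eqP; ring); apply: Or44; apply/eqP; ring.
Qed.

Lemma mem_nbhd_shiftP (x z : 'Z_n) d :
  reflect (exists2 i, i \in map (addn d) nbhd_offsets & z = (x + i%:R)%R)
          (z \in N (x + (d + 3)%:R)%R).
Proof.
rewrite natrD addrA; apply: (iffP (mem_nbhdP _ _)) => [[i hi ->]|[_ /mapP[i hi ->] ->]].
  by exists (d + i); rewrite ?map_f // natrD addrA.
by exists i => //; rewrite natrD addrA.
Qed.

Lemma natZn_neq0 d : 0 < d <= 4 -> (d%:R != 0 :> 'Z_n)%R.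
Proof.
move=> d_bd; apply/eqP => /(congr1 val) /=.
by rewrite val_Zp_nat ?modn_small; lia.
Qed.

Lemma dominated (x : 'Z_n) :
  exists2 i, i \in nbhd_offsets & (x + i%:R)%R \in S.
Proof.
have [uS|uS] := boolP ((x + 3%:R)%R \in S); first by exists 3.
have /andP[/forallP/(_ (x + 3%:R)%R) + _] := codeS.
rewrite inE uS => /set0Pn[z]; rewrite inE => /andP[/mem_nbhdP[i hi ->] zS].
by exists i.
Qed.

(** If x+3 or x+d+3 is in [S], it is itself a hit, since for d = 2, 4 neither lies at an offset of
    the other. Otherwise their traces on [S] differ, so [S] meets the symmetric difference of the
    two neighbourhoods. *)
Lemma separated (x : 'Z_n) d : d \in [:: 2; 4] ->
  exists2 i, (i \in nbhd_offsets) (+) (i \in map (addn d) nbhd_offsets)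
           & (x + i%:R)%R \in S.
Proof.
move=> hd.
have [uS|uS] := boolP ((x + 3%:R)%R \in S).
  by exists 3 => //; move: hd; rewrite !inE => /orP[] /eqP->.
have [vS|vS] := boolP ((x + (d + 3)%:R)%R \in S).
  by exists (d + 3) => //; move: hd; rewrite !inE => /orP[] /eqP->.
have /andP[_ /forallP/(_ (x + 3%:R)%R)] := codeS.
rewrite inE uS => /forallP/(_ (x + (d + 3)%:R)%R); rewrite inE vS => /implyP.
have uv : (x + 3%:R != x + (d + 3)%:R)%R.
  rewrite eq_sym natrD -subr_eq0 addrA [(x + d%:R)%R]addrC -addrA addrK.
  by apply: natZn_neq0; move: hd; rewrite !inE => /orP[] /eqP->.
move/(_ isT)/implyP/(_ uv) => neq.
have /existsP[z] : [exists z, (z \in N (x + 3%:R)%R :&: S)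
                              != (z \in N (x + (d + 3)%:R)%R :&: S)].
  apply: contraR neq => /existsPn eqz.
  by apply/eqP/setP => z; apply/eqP/negPn/eqz.
rewrite !in_setI; have [zS|] := boolP (z \in S); last by rewrite !andbF.
rewrite !andbT -negb_add negbK; have [/mem_nbhdP[i hi zE] /= zv|zu /=] :=
  boolP (z \in N (x + 3%:R)%R); last move=> /mem_nbhd_shiftP[i hi zE].
(* Distinct offsets may name the same vertex mod n, so [i] is excluded from the other list through
   [z], which is not in the other neighbourhood. *)
- exists i; rewrite -?zE // hi /=; apply: contraNN zv => hi'.
  by apply/mem_nbhd_shiftP; exists i.
- exists i; rewrite -?zE // hi addbT; apply: contraNN zu => hi'.
  by apply/mem_nbhdP; exists i.
Qed.

Lemma window_admissible x : admissible (window 11 x).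
Proof.
have hit i c : i \in c -> all (gtn 11) c -> (x + i%:R)%R \in S ->
    has (nth false (window 11 x)) c.
  by move=> ic /allP/(_ i ic) i11 iS; apply/hasP; exists i; rewrite ?nth_mkseq.
have sep d c : d \in [:: 2; 4] -> all (gtn 11) c ->
    c =i [seq i <- nbhd_offsets ++ map (addn d) nbhd_offsets |
           (i \in nbhd_offsets) (+) (i \in map (addn d) nbhd_offsets)] ->
    has (nth false (window 11 x)) c.
  move=> /(separated x)[i hi iS] c11 cE; apply: hit iS => //.
  by rewrite cE mem_filter hi mem_cat; move: hi; do 2!case: (_ \in _).
have [i hi iS] := dominated x.
apply/and4P; split=> //; first exact: hit iS.
- by apply: (sep 2) => // i'; rewrite !inE; lia.
- by apply: (sep 4) => // i'; rewrite !inE; lia.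
Qed.

Lemma behead_window k x : behead (window k.+1 x) = window k (x + 1)%R.
Proof.
rewrite /window /mkseq /= -[1]addn0 iotaDl -map_comp.
by apply: eq_map => i /=; rewrite add1n -natr1 [(i%:R + 1)%R]addrC addrA.
Qed.

Lemma take_window k x : take k (window k.+1 x) = window k x.
Proof. by rewrite /window -map_take take_iota (minn_idPl (leqnSn k)). Qed.

Lemma locating_code_card_ge : n <= 3 * #|S|.
Proof.
pose P x := potential (window 10 x).
have step x : P x + 1 <= P (x + 1)%R + 3 * (x \in S).
  have := @potential_step (window 11 x) (size_mkseq _ _) (window_admissible x).
  by rewrite take_window behead_window /= addr0 addn1.
have : \sum_x (P x + 1) <= \sum_x (P (x + 1)%R + 3 * (x \in S)).
  by apply: leq_sum => x _.
(* Translation by 1 permutes the cycle, so the potential cancels from the summed inequality. *)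
have shift : \sum_x P (x + 1)%R = \sum_x P x.
  by rewrite [RHS](reindex_inj (addIr 1%R)).
have count : \sum_x 3 * (x \in S) = 3 * #|S|.
  rewrite -sum1_card [in RHS]big_mkcond big_distrr /=.
  by apply: eq_bigr => x _; case: (x \in S).
rewrite 2!big_split /= shift count leq_add2l sum1_card card_ord.
(* ['Z_n] has n elements only because n > 1. *)
by apply: leq_trans; rewrite Zp_cast // (leq_trans _ n_gt4).
Qed.

End Circulant.

Theorem theorem1 (n : nat) (hn : 13 <= n) :
  ((n%:R / 3%:R : rat) <= (gammaLOC (@circulant13 n))%:R)%R.
Proof.
have [[S codeS <-] _] := gammaLOC_spec (@circulant13 n).
rewrite ler_pdivrMr ?ltr0n // -natrM ler_nat mulnC.
by apply: locating_code_card_ge codeS; lia.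
Qed.
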